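(* Let $\gamma\in\mathbb{R}$, $\psi:\mathbb{N}\to[0,\tfrac12]$, and let $\mathcal{I}_q\subseteq\mathbb{Z}_q$ ($q\in\mathbb{N}$) be such that $\tfrac1q\mathcal{I}_q$ is uniformly distributed modulo 1, i.e. for all $0\le x\le y\le1$, $$\lim_{q\to\infty}\frac{\#\{a\in\mathcal{I}_q: a/q\in[x,y)\}}{|\mathcal{I}_q|}=y-x.$$ Suppose there exist constants $C'>0$, $c>0$ and finite sets $\mathcal{S}_k\subset\mathbb{Z}$ with $\min\mathcal{S}_k\to+\infty$ such that for all sufficiently large $k$, $$\sum_{q\in\mathcal{S}_k}\frac{|\mathcal{I}_q|\psi(q)}{q}\ge c\qquad\text{and}\qquad\sum_{\substack{r<q\\ q,r\in\mathcal{S}_k}}\mu(E_q^{\mathcal{I}}\cap E_r^{\mathcal{I}})\le C'\Big(\sum_{q\in\mathcal{S}_k}\frac{|\mathcal{I}_q|\psi(q)}{q}\Big)^2.$$ Then $\mu(\limsup_{q\to\infty}E_q^{\mathcal{I}})=1$.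
   Context: $\mu$ is Lebesgue measure, $\mathbb{Z}_q=\{0,\dots,q-1\}$, $\|y\|$ is the distance from $y$ to the nearest integer, and $$E_q^{\mathcal{I}}=E_q^{\mathcal{I}}(\gamma,\psi):=\Big\{x\in[0,1]:\Big\|x-\frac{a+\gamma}{q}\Big\|\le\frac{\psi(q)}{q}\text{ for some }a\in\mathcal{I}_q\Big\}.$$ *)

(* Defs.v *)
From HB Require Import structures.
From mathcomp Require Import all_boot all_order all_algebra.
From mathcomp Require Import all_classical all_reals all_analysis.
Set Implicit Arguments. Unset Strict Implicit. Unset Printing Implicit Defensive.
Import Order.TTheory GRing.Theory Num.Theory.
Local Open Scope classical_set_scope.
Local Open Scope ring_scope.

Definition dnint {R : realType} (y : R) : R :=
  Num.min (y - (Num.floor y)%:~R) ((Num.ceil y)%:~R - y).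

Definition Eset {R : realType} (I : forall q : nat, {set 'I_q}) (gamma : R)
  (psi : nat -> R) (q : nat) : set R :=
  [set x : R | (0 <= x <= 1) /\
     exists2 a : 'I_q, a \in I q &
       dnint (x - ((a : nat)%:R + gamma) / q%:R) <= psi q / q%:R].

(* Main.v *)
Require Import Defs.
From HB Require Import structures.
From mathcomp Require Import all_boot all_order all_algebra.
From mathcomp Require Import all_classical all_reals all_analysis.
From mathcomp Require Import measurable_realfun finmap zify ring lra.
Import Order.TTheory GRing.Theory Num.Theory.
Import numFieldNormedType.Exports.
Local Open Scope classical_set_scope.
Local Open Scope ring_scope.

(* Fix [M], let [B] be the part of [0, 1[ not covered by the [E_q] with [q >= M],
   and suppose that [B] has measure [b > 0].  Choose an open [U] containing [B]
   with [D = U \ B] tiny, and finitely many cells of a grid, contained in [U] and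
   of total measure more than [b / 2].  Uniform distribution makes every [E_q] with
   [q] large occupy at least its fair share of each cell, up to a constant; since
   [E_q] misses [B], this mass lies in [D].  Hence, with
   [X = \sum_(q in S_k) |I_q| psi(q) / q], the sum over [q] in [S_k] of the
   measures of [E_q `&` D] is at least [b X / 2].  By Cauchy-Schwarz, the overlap
   estimate bounds the same sum by a constant times [X] times the square root of
   the measure of [D], which is a contradiction when [D] is small enough.  No
   density theorem is needed, because [U] is compared with all of [B] at once. *)

(** * Finite families of sets, the second moment, and symmetric double sums *)

Lemma le_measure_cover (d : measure_display) (T : measurableType d)
    (R : realType) (mu : {measure set T -> \bar R}) (I : eqType) (s : seq I)
    (F : I -> set T) (A : set T) :
  measurable A -> (forall i, measurable (F i)) ->
  A `<=` [set x | exists2 i, i \in s & F i x] ->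
  (mu A <= \sum_(i <- s) mu (F i))%E.
Proof.
move=> + mF; elim: s A => [|i s IH] A mA AF.
  rewrite big_nil; have -> : A = set0 by rewrite -subset0 => x /AF [].
  by rewrite measure0.
rewrite big_cons (measureDI mu mA (mF i)) addeC; apply: leeD.
  by apply: le_measure; [exact/mem_set/measurableI|exact/mem_set|exact: subIsetr].
apply: IH; first exact: measurableD.
move=> x [/AF /= [j]]; rewrite inE => /orP[/eqP -> //|js Fj _].
by exists j.
Qed.

Lemma le_sum_measure_disjoint (d : measure_display) (T : measurableType d)
    (R : realType) (mu : {measure set T -> \bar R}) (I : eqType) (s : seq I)
    (F : I -> set T) (A : set T) :
  measurable A -> (forall i, measurable (F i)) -> uniq s ->
  (forall i, i \in s -> F i `<=` A) ->
  (forall i j, i \in s -> j \in s -> i != j -> F i `&` F j = set0) ->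
  (\sum_(i <- s) mu (F i) <= mu A)%E.
Proof.
move=> + mF; elim: s A => [|i s IH] A mA.
  by rewrite big_nil measure_ge0.
move=> /= /andP[is_ us] FA Fd.
rewrite big_cons (measureDI mu mA (mF i)) addeC; apply: leeD.
  apply: IH => //; first exact: measurableD.
    move=> j js x Fx; split; first by apply: (FA j) => //; rewrite inE js orbT.
    move=> Fix; have ij : i != j by apply: contraNneq is_ => ->.
    have : (F i `&` F j) x by [].
    by rewrite Fd ?inE ?eqxx ?js ?orbT.
  by move=> j k js ks; apply: Fd; rewrite inE ?js ?ks orbT.
by rewrite setIidr//; apply: FA; rewrite inE eqxx.
Qed.

(* This is Cauchy-Schwarz for the counting function [\sum_i \1_(E i)], in the
   AM-GM form [2 N 1_D <= t N^2 + t^-1 1_D]. *)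
Lemma measure_second_moment (d : measure_display) (T : measurableType d)
    (R : realType) (mu : {measure set T -> \bar R}) (I : Type) (s : seq I)
    (E : I -> set T) (D : set T) (t : R) :
  measurable D -> (forall i, measurable (E i)) -> 0 < t ->
  (2%:E * \sum_(i <- s) mu (E i `&` D)
    <= t%:E * (\sum_(i <- s) \sum_(j <- s) mu (E i `&` E j))
       + t^-1%:E * mu D)%E.
Proof.
move=> mD mE t0.
have mI (A : set T) :
    measurable A -> measurable_fun setT (EFin \o (\1_A : T -> R)).
  by move=> mA; apply/measurable_EFinP; exact: measurable_indic.
have iI (A : set T) : measurable A -> (\int[mu]_x (\1_A x : R)%:E = mu A)%E.
  by move=> mA; rewrite integral_indic// setIT.
have p0 (A : set T) x : (0 <= (\1_A x : R)%:E)%E by rewrite lee_fin.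
have mS (F : I -> set T) : (forall i, measurable (F i)) ->
    measurable_fun setT (fun x => \sum_(i <- s) (\1_(F i) x : R)%:E : \bar R)%E.
  by move=> mF; apply: emeasurable_sum => i; exact: mI.
have pS (F : I -> set T) x : (0 <= \sum_(i <- s) (\1_(F i) x : R)%:E)%E.
  by apply: sume_ge0.
have iS (F : I -> set T) : (forall i, measurable (F i)) ->
    (\int[mu]_x \sum_(i <- s) (\1_(F i) x : R)%:E = \sum_(i <- s) mu (F i))%E.
  move=> mF; rewrite ge0_integral_sum//; first by apply: eq_bigr => i _; exact: iI.
  by move=> i; exact: mI.
have mED i : measurable (E i `&` D) by exact: measurableI.
have mEE i j : measurable (E i `&` E j) by exact: measurableI.
have mSS : measurable_fun setT
    (fun x => \sum_(i <- s) \sum_(j <- s) (\1_(E i `&` E j) x : R)%:E : \bar R)%E.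
  by apply: emeasurable_sum => i; exact: mS.
have pSS x : (0 <= \sum_(i <- s) \sum_(j <- s) (\1_(E i `&` E j) x : R)%:E)%E.
  by apply: sume_ge0.
(* Each side becomes the integral of one nonnegative combination of indicators, so that only a
   pointwise inequality remains. *)
rewrite -iS// -ge0_integralZl//; last exact: mS.
have -> : (\sum_(i <- s) \sum_(j <- s) mu (E i `&` E j) =
    \int[mu]_x \sum_(i <- s) \sum_(j <- s) (\1_(E i `&` E j) x : R)%:E)%E.
  rewrite ge0_integral_sum//; last by move=> i; exact: mS.
  by apply: eq_bigr => i _; rewrite iS.
rewrite -ge0_integralZl//; last by rewrite lee_fin ltW.
rewrite -iI// -ge0_integralZl//; [|exact: mI|by rewrite lee_fin invr_ge0 ltW].
rewrite -ge0_integralD//; last 4 first.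
- by move=> x _; apply: mule_ge0 => //; rewrite lee_fin ltW.
- exact: measurable_funeM.
- by move=> x _; apply: mule_ge0 => //; rewrite lee_fin invr_ge0 ltW.
- by apply: measurable_funeM; exact: mI.
apply: ge0_le_integral => //.
- by move=> x _; apply: mule_ge0.
- by apply: measurable_funeM; exact: mS.
- apply: emeasurable_funD; apply: measurable_funeM => //; exact: mI.
move=> x _.
set N : R := \sum_(i <- s) \1_(E i) x.
have -> : (\sum_(i <- s) (\1_(E i `&` D) x : R)%:E = (N * \1_D x)%:E)%E.
  by rewrite sumEFin mulr_suml; congr EFin; apply: eq_bigr => i _; rewrite indicI.
have -> : (\sum_(i <- s) \sum_(j <- s) (\1_(E i `&` E j) x : R)%:E = (N * N)%:E)%E.
  rewrite /N mulr_suml -sumEFin; apply: eq_bigr => i _.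
  by rewrite sumEFin mulr_sumr; congr EFin; apply: eq_bigr => j _; rewrite indicI.
rewrite -!EFinM -EFinD lee_fin indicE.
(* Off [D] the left side vanishes; on [D] the difference of the two sides is a completed square. *)
case: (x \in D) => /=; last first.
  by rewrite !mulr0 addr0; apply: mulr_ge0; [exact: ltW|rewrite -expr2 sqr_ge0].
rewrite !mulr1 -subr_ge0.
have -> : t * (N * N) + t^-1 - 2 * N = t^-1 * (t * N - 1) ^+ 2.
  by field; rewrite gt_eqF.
by rewrite mulr_ge0 ?sqr_ge0// invr_ge0 ltW.
Qed.

(** The second moment runs over all ordered pairs, whereas the overlap hypothesis concerns [r < q]
    only; the diagonal has to be bounded separately. *)
Lemma sum_sym_pairs (R : pzRingType) (s : seq nat) (f : nat -> nat -> R) :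
  uniq s -> (forall q r, f q r = f r q) ->
  \sum_(q <- s) \sum_(r <- s) f q r =
  \sum_(q <- s) f q q + 2 * \sum_(q <- s) \sum_(r <- s | (r < q)%N) f q r.
Proof.
move=> us fC.
have E q : q \in s -> \sum_(r <- s) f q r =
    f q q + \sum_(r <- s | (r < q)%N) f q r + \sum_(r <- s | (q < r)%N) f q r.
  move=> qs; rewrite (bigD1_seq q)//= -addrA; congr (_ + _).
  rewrite (bigID (fun r => (r < q)%N))/=; congr (_ + _).
    by apply: eq_bigl => r; rewrite andbC; case: ltngtP.
  by apply: eq_bigl => r; case: ltngtP.
rewrite big_seq (eq_bigr _ E) -big_seq !big_split/= -addrA; congr (_ + _).
rewrite mulr2n mulrDl mul1r; congr (_ + _).
(* Swapping the summations turns the pairs with [q < r] into those with [r < q]. *)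
rewrite (exchange_big_dep xpredT)//=.
by apply: eq_bigr => q _; apply: eq_bigr => r _; rewrite fC.
Qed.

(** * Distance to the nearest integer, and measure bounds for [Eset] *)

(** The floor is the closest integer from below and the ceiling the closest from above, so any
    integer [m] within [r] of [y] can be replaced by one of them. *)
Lemma dnint_leP (R : realType) (y r : R) :
  dnint y <= r <-> exists m : int, `|y - m%:~R| <= r.
Proof.
have fy : (Num.floor y)%:~R <= y by exact: floor_le.
have yc : y <= (Num.ceil y)%:~R by exact: ceil_ge.
split.
  rewrite /dnint ge_min => /orP[h|h].
    by exists (Num.floor y); rewrite ger0_norm// subr_ge0.
  by exists (Num.ceil y); rewrite ler0_norm ?opprB// subr_le0.
case=> m h; rewrite /dnint ge_min; have [my|ym] := leP m%:~R y.
  apply/orP; left; rewrite ger0_norm ?subr_ge0// in h.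
  by apply: le_trans h; rewrite lerD2l lerN2 ler_int floor_ge_int.
apply/orP; right; rewrite ltr0_norm ?subr_lt0// opprB in h.
by apply: le_trans h; rewrite lerD2r ler_int ceil_le_int ltW.
Qed.

(** The closed ball of the circle R/Z, seen in [0, 1]. The set [Eset] at [q] is a finite union of
    such balls. *)
Definition circle_ball {R : realType} (c r : R) : set R :=
  [set x : R | (0 <= x <= 1) /\ dnint (x - c) <= r].

Lemma measurable_circle_ball (R : realType) (c r : R) :
  measurable (circle_ball c r).
Proof.
have -> : circle_ball c r = [set` `[0, 1]] `&`
    \bigcup_(m : int) [set` `[c + m%:~R - r, c + m%:~R + r]].
  apply/seteqP; split => x /=; rewrite /circle_ball /= in_itv /=.
    move=> [x01 /dnint_leP[m]]; rewrite ler_norml => h; split => //.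
    by exists m => //=; rewrite in_itv /=; lra.
  move=> [x01 [m _ /=]]; rewrite in_itv /= => h; split => //.
  by apply/dnint_leP; exists m; rewrite ler_norml; lra.
apply: measurableI => //; apply: countable_bigcupT_measurable => //.
Qed.

(* Only three integer translates of a ball of radius at most [1/2] meet [0, 1],
   whence the non-optimal constant. *)
Lemma measure_circle_ball_le (R : realType) (c r : R) :
  0 <= r <= 2^-1 -> (lebesgue_measure (circle_ball c r) <= (6 * r)%:E)%E.
Proof.
move=> r0.
(* With the center reduced to [0, 1[, a point of [0, 1] within 1/2 of [c' + k] forces [k] to be -1,
   0 or 1. *)
pose c' := c - (Num.floor c)%:~R.
have c'0 : 0 <= c' by rewrite subr_ge0 floor_le.
have c'1 : c' < 1 by rewrite ltrBlDr addrC -intrD1 floorD1_gt.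
pose F (k : int) := [set` `[c' + k%:~R - r, c' + k%:~R + r]] : set R.
have mF k : measurable (F k) by exact: measurable_itv.
have muF k : lebesgue_measure (F k) = (2 * r)%:E.
  (* The second case of the length formula, with value 0, occurs only for [r = 0]. *)
  rewrite /F lebesgue_measure_itv /= lte_fin; case: ifPn => h.
    by rewrite -EFinB; congr EFin; ring.
  by congr EFin; lra.
pose s : seq int := [:: -1; 0; 1].
have -> : (6 * r)%:E = (\sum_(k <- s) lebesgue_measure (F k))%E.
  by rewrite !big_cons big_nil !muF -!EFinD; congr EFin; ring.
apply: le_measure_cover => //; first exact: measurable_circle_ball.
move=> x [x01 /dnint_leP[m]]; rewrite ler_norml => hm.
pose j := m + Num.floor c.
have jE : j%:~R = m%:~R + (Num.floor c)%:~R :> R by rewrite intrD.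
have cE : c = c' + (Num.floor c)%:~R by rewrite subrK.
have j1 : j < 2 by rewrite -(ltr_int R) jE; lra.
have j2 : - 2 < j by rewrite -(ltr_int R) jE; lra.
exists j; first by rewrite !inE; lia.
by rewrite /F /= in_itv /= jE; lra.
Qed.

Lemma EsetE (R : realType) (I : forall q : nat, {set 'I_q}) (gamma : R)
    (psi : nat -> R) (q : nat) :
  Eset I gamma psi q = \big[setU/set0]_(a <- enum (I q))
    circle_ball ((a%:R + gamma) / q%:R) (psi q / q%:R).
Proof.
rewrite -bigcup_seq; apply/seteqP; split => x /=.
  by move=> [x01 [a aI h]]; exists a => //=; rewrite mem_enum.
by move=> [a /=]; rewrite mem_enum => aI [x01 h]; split => //; exists a.
Qed.

Lemma measurable_Eset (R : realType) (I : forall q : nat, {set 'I_q})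
    (gamma : R) (psi : nat -> R) (q : nat) :
  measurable (Eset I gamma psi q).
Proof.
by rewrite EsetE; apply: bigsetU_measurable => a _; exact: measurable_circle_ball.
Qed.

Lemma measure_Eset_le (R : realType) (I : forall q : nat, {set 'I_q})
    (gamma : R) (psi : nat -> R) (q : nat) :
  0 <= psi q <= 2^-1 ->
  (lebesgue_measure (Eset I gamma psi q) <= (6 * (#|I q|%:R * psi q / q%:R))%:E)%E.
Proof.
move=> /andP[p0 p1].
have r0 : 0 <= psi q / q%:R <= 2^-1.
  (* At [q = 0] the inverse is 0 by convention, hence so is the radius. *)
  rewrite divr_ge0//=; case: q p0 p1 => [|q] p0 p1.
    by rewrite invr0 mulr0 invr_ge0.
  by rewrite ler_pdivrMr// (le_trans p1)// ler_peMr// ler1n.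
apply: (@le_trans _ _ (\sum_(a <- enum (I q)) lebesgue_measure
    (circle_ball ((a%:R + gamma) / q%:R) (psi q / q%:R)))%E).
  apply: le_measure_cover; first exact: measurable_Eset.
    by move=> a; exact: measurable_circle_ball.
  by move=> x [x01 [a aI h]]; exists a; rewrite ?mem_enum.
apply: le_trans (lee_sum _ (fun a _ => measure_circle_ball_le _ _ _ r0)) _.
rewrite sumEFin lee_fin big_enum /= sumr_const -mulr_natl.
by rewrite le_eqVlt; apply/orP; left; apply/eqP; ring.
Qed.

(** For large [q], at least half the expected number of points [a / q] lie in [x, y[ at distance [e]
    or more from its ends. The shift by [gamma / q] and the radius together stay below [e], so the
    corresponding intervals remain in [x, y[. They are disjoint and have length [2 psi q / q]; this
    factor 2 makes up for the lost half. *)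
Lemma measure_Eset_itv_ge (R : realType) (I : forall q : nat, {set 'I_q})
    (gamma : R) (psi : nat -> R) (x y : R) :
  (forall q, 0 <= psi q <= 2^-1) ->
  (forall x y : R, 0 <= x -> x <= y -> y <= 1 ->
     (fun q : nat => (#|[set a in I q | (x <= (a : nat)%:R / q%:R < y)]|%:R
                       / #|I q|%:R : R)) @ \oo --> y - x) ->
  0 <= x -> x < y -> y <= 1 ->
  \forall q \near \oo, (((y - x) * (#|I q|%:R * psi q / q%:R))%:E
    <= lebesgue_measure (Eset I gamma psi q `&` [set` `[x, y[]))%E.
Proof.
move=> psi12 ud x0 xy y1.
(* The shrunken interval has length [3 (y - x) / 4], which leaves room above the required density
   [(y - x) / 2]. *)
pose e := (y - x) / 8.
have e0 : 0 < e by rewrite divr_gt0// subr_gt0.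
have eE : y - x = 8 * e by rewrite /e; field.
have lim := ud (x + e) (y - e) ltac:(lra) ltac:(lra) ltac:(lra).
have half : (y - x) / 2 < y - e - (x + e) by lra.
have near1 := cvgr_gt _ lim _ half.
have near2 : \forall q \near \oo, (`|gamma| + 1) / e < (q%:R : R).
  exact: nbhs_infty_gtr.
have [N1 _ {}near1] := near1; have [N2 _ {}near2] := near2.
exists (maxn N1 N2) => // q /=; rewrite geq_max => /andP[/near1 {}near1 /near2 {}near2].
rewrite /= in near1 near2.
set J := [set a in I q | _] in near1.
have [p0 p1] := andP (psi12 q).
have q0 : 0 < (q%:R : R).
  by apply: le_lt_trans near2; rewrite divr_ge0 ?ltW// ltr_wpDl.
have cardJ : (y - x) / 2 * #|I q|%:R <= #|J|%:R.
  have [->|I0] := eqVneq #|I q| 0%N; first by rewrite mulr0.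
  by rewrite -ler_pdivlMr ?ltW// ltr0n lt0n.
have ge : (`|gamma| + 1) / q%:R < e by rewrite ltr_pdivrMr// mulrC -ltr_pdivrMr.
pose r := psi q / q%:R.
have rE : psi q = r * q%:R by rewrite /r divfK// gt_eqF.
have r0 : 0 <= r by rewrite divr_ge0// ltW.
have rq : 2 * r <= q%:R^-1.
  by rewrite -[q%:R^-1]mul1r ler_pdivlMr// -mulrA -rE; lra.
(* The centers are at least [1 / q >= 2 r] apart. Half-open intervals are disjoint even when
   neighbors touch, as may happen for [psi q = 1/2]. *)
pose F (a : 'I_q) := [set` `[(a%:R + gamma) / q%:R - r, (a%:R + gamma) / q%:R + r[] : set R.
have mF a : measurable (F a) by exact: measurable_itv.
have muF a : lebesgue_measure (F a) = (2 * r)%:E.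
  rewrite /F lebesgue_measure_itv /= lte_fin; case: ifPn => h.
    by rewrite -EFinB; congr EFin; ring.
  by congr EFin; lra.
apply: (@le_trans _ _ (\sum_(a <- enum J) lebesgue_measure (F a))%E).
  rewrite (eq_bigr _ (fun a _ => muF a)) sumEFin lee_fin big_enum /= sumr_const.
  rewrite -mulr_natl -mulrA -/r.
  have : 0 <= (#|J|%:R - (y - x) / 2 * #|I q|%:R) * r by rewrite mulr_ge0// subr_ge0.
  by lra.
apply: le_sum_measure_disjoint => //.
- by apply: measurableI => //; exact: measurable_Eset.
- exact: enum_uniq.
- move=> a; rewrite mem_enum inE => /andP[aI /andP[h1 h2]] z.
  rewrite /F /= in_itv /= mulrDl => zF.
  have g1 : `|gamma / q%:R| + q%:R^-1 < e.
    by rewrite normrM normfV (gtr0_norm q0) -[X in _ + X]mul1r -mulrDl.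
  have g2 := ler_norm (gamma / q%:R).
  have g3 := ler_norm (- (gamma / q%:R)).
  rewrite normrN in g3.
  split; last by rewrite /= in_itv /=; lra.
  split; first lra.
  exists a => //; apply/dnint_leP; exists 0; rewrite subr0 -/r ler_norml mulrDl; lra.
have disj (a b : 'I_q) : (a < b)%N -> F a `&` F b = set0.
  move=> ab; rewrite -subset0 => z []; rewrite /F /= !in_itv /= !mulrDl => za zb.
  have : (a%:R + 1) / q%:R <= b%:R / q%:R :> R.
    by rewrite ler_pM2r ?invr_gt0// natr1 ler_nat.
  by rewrite mulrDl mul1r; lra.
move=> a b _ _; rewrite neq_ltn => /orP[|] h; first exact: disj.
by rewrite setIC; exact: disj.
Qed.

(** * Approximation of open sets from inside by grid cells *)

Definition grid_cell {R : realType} (n i : nat) : set R :=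
  [set` `[i%:R / n%:R, i.+1%:R / n%:R[].

Lemma measure_grid_cell (R : realType) (n i : nat) : (0 < n)%N ->
  lebesgue_measure (grid_cell n i : set R) = (n%:R^-1)%:E.
Proof.
move=> n0; rewrite /grid_cell lebesgue_measure_itv /= lte_fin.
rewrite ltr_pM2r ?invr_gt0 ?ltr0n// ltr_nat ltnSn -EFinB; congr EFin.
by rewrite -mulrBl -natrB ?subSn ?leqnSn// subnn mul1r.
Qed.

Lemma grid_cell_disjoint (R : realType) (n i j : nat) : (0 < n)%N -> i != j ->
  (grid_cell n i : set R) `&` grid_cell n j = set0.
Proof.
move=> n0 ij; rewrite -subset0 => x [] /=; rewrite /grid_cell /= !in_itv /=.
rewrite !ler_pdivrMr ?ltr0n// !ltr_pdivlMr ?ltr0n// => /andP[a1 a2] /andP[b1 b2].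
have := le_lt_trans a1 b2; have := le_lt_trans b1 a2; rewrite !ltr_nat !ltnS => ji ij'.
by move: ij; rewrite eqn_leq ij' ji.
Qed.

(** Around a point of [U] in [0, 1[, the cells of every sufficiently fine grid lie in [U].
    Continuity of the measure from below then yields one mesh that captures measure more than
    [b]. *)
Lemma open_grid_approx (R : realType) (U : set R) (b : R) : open U ->
  (b%:E < lebesgue_measure (U `&` [set` `[0%R, 1%R[]))%E ->
  exists (n : nat) (L : seq nat), [/\ (0 < n)%N, uniq L,
    forall i, i \in L -> (i < n)%N /\ grid_cell n i `<=` U &
    b < (size L)%:R / n%:R].
Proof.
move=> oU bU.
pose P n := [set i | (i < n)%N /\ (grid_cell n i : set R) `<=` U].
pose V n : set R := \bigcup_(i in P n.+1) grid_cell n.+1 i.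
(* Successive grids are not nested, so [V] need not be monotone; intersecting over tails gives an
   increasing sequence. The index is shifted by one to keep the mesh [1 / n.+1] meaningful at 0. *)
pose W N := \bigcap_(n in [set n | (N <= n)%N]) V n.
have mV n : measurable (V n) by apply: bigcup_measurable => i _; exact: measurable_itv.
have mW N : measurable (W N) by apply: bigcap_measurable => //; exists N => /=.
have UW : U `&` [set` `[0, 1[] = \bigcup_N W N.
  apply/seteqP; split => x.
    move=> [Ux]; rewrite /= in_itv /= => /andP[x0 x1].
    have [e /= e0 eU] := (nbhs_ballP _ _).1 (open_nbhs_nbhs (conj oU Ux)).
    have [N _ hN] : \forall n \near \oo, e^-1 < (n%:R : R) by exact: nbhs_infty_gtr.
    exists N => // n /= Nn.
    have en : e^-1 < (n.+1%:R : R).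
      by apply: (lt_le_trans (hN N _)) => //=; rewrite ler_nat leqW.
    have n0 : (0 : R) < n.+1%:R by [].
    have xn0 : 0 <= x * n.+1%:R by rewrite mulr_ge0.
    have /andP[t1 t2] := truncn_itv xn0.
    exists (Num.truncn (x * n.+1%:R)); last first.
      by rewrite /grid_cell /= in_itv /= ler_pdivrMr// ltr_pdivlMr// t1.
    split.
      by rewrite -(ltr_nat R); apply: (le_lt_trans t1); rewrite gtr_pMl.
    move=> z; rewrite /grid_cell /= in_itv /= => /andP[z1 z2]; apply: eU.
    have ei : n.+1%:R^-1 < e by rewrite invf_plt// posrE.
    rewrite ler_pdivrMr// in z1; rewrite ltr_pdivlMr// in z2.
    rewrite /ball /=; apply: lt_trans ei.
    rewrite -[X in _ < X]mul1r ltr_pdivlMr// -[X in _ * X](gtr0_norm n0) -normrM ltr_norml.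
    by rewrite -(natr1 (Num.truncn _)) in t2 z2; lra.
  move=> [N _ /(_ N (leqnn N))] [i [iN iU]] xi; split; first exact: iU.
  move: xi; rewrite /grid_cell /= !in_itv /= => /andP[x1 x2].
  rewrite (le_trans _ x1) ?divr_ge0//=; apply: (lt_le_trans x2).
  by rewrite ler_pdivrMr ?ltr0n// mul1r ler_nat.
have cv : (lebesgue_measure \o W) @ \oo --> lebesgue_measure (\bigcup_N W N).
  apply: nondecreasing_cvg_mu => //; first exact: bigcupT_measurable.
  by move=> N N' NN'; apply/subsetPset => x Wx n /= Nn; apply: Wx => /=; exact: leq_trans Nn.
rewrite UW in bU.
have bn : nbhs (lebesgue_measure (\bigcup_N W N)) [set y | (b%:E < y)%E].
  by apply: open_nbhs_nbhs; split => //; exact: open_ereal_gt_ereal.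
have [N _ /(_ N (leqnn N)) /= bW] := cv _ bn.
exists N.+1; pose L := [seq i <- iota 0 N.+1 | `[< P N.+1 i >]]; exists L; split => //.
- by rewrite filter_uniq// iota_uniq.
- by move=> i; rewrite mem_filter => /andP[/asboolP].
rewrite -lte_fin; apply: (lt_le_trans bW).
have -> : ((size L)%:R / N.+1%:R)%:E =
    (\sum_(i <- L) lebesgue_measure (grid_cell N.+1 i : set R))%E.
  rewrite (eq_bigr _ (fun i _ => measure_grid_cell R N.+1 i (ltn0Sn N))) sumEFin.
  by rewrite big_const_seq count_predT iter_addr_0 mulr_natl.
apply: le_measure_cover; [exact: mW|by move=> i; exact: measurable_itv|].
move=> x /(_ N (leqnn N)) [i Pi xi]; exists i => //.
rewrite mem_filter mem_iota /= add0n; apply/andP; split; first exact/asboolP.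
by case: Pi.
Qed.

(** * Full measure of the tails, and passage to the limsup *)

Lemma near_infty_all (T : eqType) (s : seq T) (P : T -> nat -> Prop) :
  (forall i, i \in s -> \forall q \near \oo, P i q) ->
  exists N, forall i q, i \in s -> (N <= q)%N -> P i q.
Proof.
elim: s => [|i s IH] sP; first by exists 0%N.
have [j js|N1 h1] := IH; first by apply: sP; rewrite inE js orbT.
have [N2 _ h2] := sP i (mem_head i s).
exists (maxn N1 N2) => j q; rewrite inE geq_max => /orP[/eqP ->|js] /andP[q1 q2].
  exact: h2.
exact: h1.
Qed.

Lemma tail_Eset_conull (R : realType) (gamma : R) (psi : nat -> R)
  (I : forall q : nat, {set 'I_q}) (C' c : R) (S : nat -> {fset nat}) (M : nat) :
  (forall q, 0 <= psi q <= 2^-1) ->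
  (forall x y : R, 0 <= x -> x <= y -> y <= 1 ->
     (fun q : nat => (#|[set a in I q | (x <= (a : nat)%:R / q%:R < y)]|%:R
                       / #|I q|%:R : R)) @ \oo --> y - x) ->
  0 < C' -> 0 < c ->
  (forall M : nat, \forall k \near \oo, forall q, q \in S k -> (M <= q)%N) ->
  (\forall k \near \oo,
     c <= \sum_(q <- S k) (#|I q|%:R * psi q / q%:R) /\
     (\sum_(q <- S k) \sum_(r <- S k | (r < q)%N)
         lebesgue_measure (Eset I gamma psi q `&` Eset I gamma psi r)
      <= (C' * (\sum_(q <- S k) (#|I q|%:R * psi q / q%:R)) ^+ 2)%:E)%E) ->
  lebesgue_measure
    ([set` `[0%R, 1%R[] `\` \bigcup_(q in [set q | (M <= q)%N]) Eset I gamma psi q) = 0%E.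
Proof.
move=> psi12 ud C0 c0 Sinf; set E := Eset I gamma psi => -[k1 _ hk].
set B : set R := _ `\` _.
have mE q : measurable (E q) by exact: measurable_Eset.
have mB : measurable B.
  by apply: measurableD => //; apply: bigcup_measurable => q _; exact: mE.
have B1 : (lebesgue_measure B <= 1)%E.
  have -> : 1%E = lebesgue_measure [set` `[0%R, 1%R[ : interval R].
    by rewrite lebesgue_measure_itv /= lte_fin ltr01 -EFinB subr0.
  by apply: le_measure; [exact/mem_set|by apply: mem_set; exact: measurable_itv|exact: subDsetl].
have Bfin : lebesgue_measure B \is a fin_num.
  by rewrite ge0_fin_numE ?measure_ge0// (le_lt_trans B1)// ltry.
pose b := fine (lebesgue_measure B).
have bE : lebesgue_measure B = b%:E by rewrite /b fineK.
have b0 : 0 <= b by rewrite -lee_fin -bE measure_ge0.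
rewrite bE; congr EFin; apply/eqP; rewrite eq_le b0 andbT leNgt; apply/negP => {}b0.
(* [K * X ^+ 2] will bound the full double sum: [2 C' X^2] comes from the pairs off the diagonal,
   and the diagonal gives at most [6 X <= (6 / c) X^2], since [c <= X]. *)
pose K := 2 * C' + 6 / c.
have K0 : 0 < K by apply: addr_gt0; [exact: mulr_gt0|exact: divr_gt0].
(* For the parameter [t = delta / X], the values of [delta] and [e] make both terms of the
   second-moment bound equal to [b X / 4]. *)
pose delta := b / (4 * K).
have d0 : 0 < delta by rewrite divr_gt0// mulr_gt0.
pose e := b * delta / 4.
have e0 : 0 < e by rewrite divr_gt0// mulr_gt0.
have [|U [oU BU Ue]] := lebesgue_regularity_outer mB _ e0.
  by rewrite (le_lt_trans B1)// ltry.
have mU : measurable U by exact: open_measurable.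
have bU : ((b / 2)%:E < lebesgue_measure (U `&` [set` `[0%R, 1%R[ : interval R]))%E.
  apply: (@lt_le_trans _ _ (lebesgue_measure B)); first by rewrite bE lte_fin; lra.
  apply: le_measure; [exact/mem_set|apply/mem_set|by move=> x Bx; split; [exact: BU|case: Bx]].
  by apply: measurableI => //; exact: measurable_itv.
have [n [L [n0 uL LU Ln]]] := open_grid_approx _ _ _ oU bU.
pose w q : R := #|I q|%:R * psi q / q%:R.
have w0 q : 0 <= w q.
  by have /andP[p0 _] := psi12 q; rewrite /w !mulr_ge0 ?invr_ge0.
(* Finiteness of [L] gives one threshold for all cells; it depends on [U], which is fixed before [k]
   is chosen. *)
have [N hN] : exists N, forall i q, i \in L -> (N <= q)%N ->
    ((n%:R^-1 * w q)%:E <= lebesgue_measure (E q `&` grid_cell n i))%E.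
  apply: near_infty_all => i iL; have [iltn _] := LU i iL.
  have -> : (n%:R^-1 : R) = i.+1%:R / n%:R - i%:R / n%:R.
    by rewrite -mulrBl -natr1 addrC addKr mul1r.
  apply: (measure_Eset_itv_ge _ _ _ _ _ _ psi12 ud).
  - by rewrite divr_ge0.
  - by rewrite ltr_pM2r ?invr_gt0 ?ltr0n// ltr_nat.
  - by rewrite ler_pdivrMr ?ltr0n// mul1r ler_nat.
have [k2 _ hS] := Sinf (maxn M N).
have [cX ov] := hk _ (leq_maxl k1 k2).
have {}hS := hS _ (leq_maxr k1 k2).
set s := S (maxn k1 k2) in cX ov hS.
pose X := \sum_(q <- s) w q.
have X0 : 0 < X by exact: lt_le_trans cX.
pose D := U `\` B.
have mD : measurable D by exact: measurableD.
(* The cells of [L] lie in [U], and [E q] misses [B] because [M <= q]; so the disjoint pieces of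
   [E q] in these cells all lie in [D]. *)
have lower q : q \in s -> ((b / 2 * w q)%:E <= lebesgue_measure (E q `&` D))%E.
  move=> qs; have := hS q qs; rewrite geq_max => /andP[Mq Nq].
  apply: (@le_trans _ _ (\sum_(i <- L) lebesgue_measure (E q `&` grid_cell n i))%E); last first.
    apply: le_sum_measure_disjoint.
    - by apply: measurableI; [exact: mE|exact: mD].
    - by move=> i; apply: measurableI; [exact: mE|exact: measurable_itv].
    - exact: uL.
    - move=> i iL x [Eqx xi]; split => //; split; first by apply: (LU i iL).2.
      by move=> [_]; apply; exists q.
    - by move=> i j _ _ ij; rewrite setIACA (grid_cell_disjoint _ _ _ _ n0 ij) setI0.
  apply: (@le_trans _ _ (\sum_(i <- L) (n%:R^-1 * w q)%:E)%E); last first.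
    by rewrite big_seq [leRHS]big_seq; apply: lee_sum => i iL; exact: hN.
  rewrite sumEFin big_const_seq count_predT iter_addr_0 lee_fin -[_ *+ size L]mulr_natl [leRHS]mulrA.
  by apply: ler_wpM2r => //; exact: ltW.
(* Finite overlaps allow the double sum to be rearranged in [R]. *)
have EEfin q r : lebesgue_measure (E q `&` E r) \is a fin_num.
  rewrite ge0_fin_numE ?measure_ge0//.
  apply: (@le_lt_trans _ _ (lebesgue_measure (E q))).
    by apply: le_measure; [apply: mem_set; apply: measurableI; exact: mE|apply: mem_set; exact: mE|exact: subIsetl].
  by apply: (le_lt_trans (measure_Eset_le _ _ _ _ _ (psi12 q))); rewrite ltry.
pose m q r := fine (lebesgue_measure (E q `&` E r)).
have mEE q r : lebesgue_measure (E q `&` E r) = (m q r)%:E by rewrite /m fineK.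
have pairs : (\sum_(q <- s) \sum_(r <- s) lebesgue_measure (E q `&` E r)
    <= (K * X ^+ 2)%:E)%E.
  have sumE (P : nat -> nat -> bool) :
      (\sum_(q <- s) \sum_(r <- s | P q r) lebesgue_measure (E q `&` E r) =
       (\sum_(q <- s) \sum_(r <- s | P q r) m q r)%:E)%E.
    rewrite -sumEFin; apply: eq_bigr => q _.
    by rewrite -sumEFin; apply: eq_bigr => r _; exact: mEE.
  move: ov; rewrite (sumE (fun q r => (r < q)%N)) (sumE (fun _ _ => true)).
  rewrite !lee_fin -/X => ov.
  rewrite sum_sym_pairs ?fset_uniq//; last by move=> q r; rewrite /m setIC.
  have diag : \sum_(q <- s) m q q <= 6 * X.
    rewrite /X mulr_sumr; apply: ler_sum => q _.
    by rewrite -lee_fin -mEE setIid; exact: measure_Eset_le.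
  have XX : 6 * X <= 6 / c * X ^+ 2.
    rewrite expr2 mulrA; apply: ler_wpM2r; first exact: ltW.
    by rewrite -mulrA ler_peMr// mulrC ler_pdivlMr// mul1r.
  by rewrite /K; lra.
have t0 : 0 < delta / X by rewrite divr_gt0.
have := measure_second_moment _ _ _ lebesgue_measure _ s E D _ mD mE t0.
apply/negP; rewrite -ltNge.
(* The value [b X] separates the two sides: it is at most twice the sum of the lower bounds, while
   the upper bound is at most [b X / 2]. *)
apply: (@lt_le_trans _ _ (b * X)%:E); last first.
  apply: (@le_trans _ _ (2%:E * (\sum_(q <- s) (b / 2 * w q)%:E))%E).
    rewrite sumEFin -EFinM lee_fin -mulr_sumr -/X.
    by rewrite le_eqVlt; apply/orP; left; apply/eqP; field.
  apply: lee_wpmul2l; first by rewrite lee_fin.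
  by rewrite big_seq [leRHS]big_seq; apply: lee_sum => q; exact: lower.
apply: (@le_lt_trans _ _ ((delta / X * (K * X ^+ 2))%:E
    + (delta / X)^-1%:E * lebesgue_measure D)%E).
  apply: leeD => //; rewrite [leRHS]EFinM; apply: lee_wpmul2l => //.
  by rewrite lee_fin ltW.
apply: (@le_lt_trans _ _ ((delta / X * (K * X ^+ 2))%:E + ((delta / X)^-1 * e)%:E)%E).
  apply: leeD => //; rewrite [leRHS]EFinM; apply: lee_wpmul2l; last exact: ltW.
  by rewrite lee_fin invr_ge0 ltW.
rewrite -EFinD lte_fin.
have -> : delta / X * (K * X ^+ 2) + (delta / X)^-1 * e = b * X / 2.
  rewrite /e /delta; field.
  by rewrite !gt_eqF.
by have : 0 < b * X; [exact: mulr_gt0|lra].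
Qed.

Theorem mainTheorem9 (R : realType) (gamma : R) (psi : nat -> R)
  (I : forall q : nat, {set 'I_q}) :
  (forall q, 0 <= psi q <= 2^-1) ->
  (forall x y : R, 0 <= x -> x <= y -> y <= 1 ->
     (fun q : nat => (#|[set a in I q | (x <= (a : nat)%:R / q%:R < y)]|%:R
                       / #|I q|%:R : R)) @ \oo --> y - x) ->
  (exists (C' c : R) (S : nat -> {fset nat}),
     [/\ 0 < C', 0 < c,
       (forall M : nat, \forall k \near \oo, forall q, q \in S k -> (M <= q)%N) &
       \forall k \near \oo,
         c <= \sum_(q <- S k) (#|I q|%:R * psi q / q%:R) /\
         (\sum_(q <- S k) \sum_(r <- S k | (r < q)%N)
             lebesgue_measure (Eset I gamma psi q `&` Eset I gamma psi r)
          <= (C' * (\sum_(q <- S k) (#|I q|%:R * psi q / q%:R)) ^+ 2)%:E)%E]) ->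
  lebesgue_measure (lim_sup_set (Eset I gamma psi)) = 1%E.
Proof.
move=> psi12 ud [C' [c [S [C0 c0 Sinf hk]]]].
set E := Eset I gamma psi.
pose T M := \bigcup_(q in [set q | (M <= q)%N]) E q.
pose U := [set` `[0%R, 1%R[ : interval R].
have mE q : measurable (E q) by exact: measurable_Eset.
have mU : measurable U by exact: measurable_itv.
have mT M : measurable (T M) by apply: bigcup_measurable => q _; exact: mE.
have mls : measurable (lim_sup_set E).
  by apply: bigcapT_measurable => M; exact: mT.
have muU : lebesgue_measure U = 1%E.
  by rewrite lebesgue_measure_itv /= lte_fin ltr01 -EFinB subr0.
apply/eqP; rewrite eq_le; apply/andP; split.
  have <- : lebesgue_measure [set` `[0%R, 1%R] : interval R] = 1%E.
    by rewrite lebesgue_measure_itv /= lte_fin ltr01 -EFinB subr0.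
  apply: le_measure; [exact/mem_set|apply: mem_set; exact: measurable_itv|].
  by move=> x /(_ 0%N Logic.I)[q _ [x01 _]]; rewrite /= in_itv.
(* The complement of the limsup in [0, 1[ is the countable union of the complements of the tails,
   each of them null. *)
have null : lebesgue_measure (U `\` lim_sup_set E) = 0%E.
  apply: measure_negligible; first exact: measurableD.
  have -> : U `\` lim_sup_set E = \bigcup_M (U `\` T M).
    by rewrite setDE setC_bigcap setI_bigcupr.
  apply: negligible_bigcup => M; apply/negligibleP; first by apply: measurableD; [exact: mU|exact: mT].
  exact: tail_Eset_conull hk.
have split_U : lebesgue_measure U =
    (lebesgue_measure (U `\` lim_sup_set E) + lebesgue_measure (U `&` lim_sup_set E))%E.
  exact: measureDI.
rewrite -muU split_U null add0e.
by apply: le_measure; [apply: mem_set; exact: measurableI|exact/mem_set|exact: subIsetr].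
Qed.
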